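(* Let $(\mathcal{X},\mathcal{D})$ and $(\mathcal{Y},\mathcal{E})$ be strongly connected digraphs, and let $\kappa\colon\mathcal{Y}\to\mathcal{X}$ be a lumping function such that $\kappa_2(\mathcal{E})=\mathcal{D}$ and $\mathcal{W}_\kappa(\mathcal{Y},\mathcal{E})\neq\emptyset$. Then a map $K_\star\colon\mathcal{F}(\mathcal{X},\mathcal{D})\to\mathcal{F}_\kappa(\mathcal{Y},\mathcal{E})$ is a $\kappa$-congruent embedding if and only if $K_\star$ is a $\kappa$-compatible Markov embedding.
   Context: All vertex sets are finite with at least two elements. For a strongly connected digraph $(\mathcal{Y},\mathcal{E})$, $\mathcal{E}\subset\mathcal{Y}^2$: $\mathcal{F}(\mathcal{Y},\mathcal{E})$ is the real vector space of functions (matrices) $A\colon\mathcal{Y}^2\to\mathbb{R}$ vanishing outside $\mathcal{E}$; $\mathcal{F}_+(\mathcal{Y},\mathcal{E})$ is the subset of those that are strictly positive on $\mathcal{E}$; $\mathcal{W}(\mathcal{Y},\mathcal{E})$ is the set of $P\in\mathcal{F}_+(\mathcal{Y},\mathcal{E})$ all of whose rows sum to $1$. Write $A(y,S)=\sum_{s\in S}A(y,s)$. A lumping function is a surjective map $\kappa\colon\mathcal{Y}\to\mathcal{X}$; $\mathcal{S}_x=\kappa^{-1}(\{x\})$, $\kappa_2(y,y')=(\kappa(y),\kappa(y'))$. A matrix $A\in\mathcal{F}(\mathcal{Y},\mathcal{E})$ is $\kappa$-lumpable if $A(y_1,\mathcal{S}_{x'})=A(y_2,\mathcal{S}_{x'})$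 for all $x,x'\in\mathcal{X}$ and $y_1,y_2\in\mathcal{S}_x$; then $\kappa_\star A(x,x')=A(y,\mathcal{S}_{x'})$ for any $y\in\mathcal{S}_x$, and $\kappa_\star A\in\mathcal{F}(\mathcal{X},\kappa_2(\mathcal{E}))$. $\mathcal{F}_\kappa(\mathcal{Y},\mathcal{E})$ is the set of $\kappa$-lumpable matrices in $\mathcal{F}(\mathcal{Y},\mathcal{E})$ and $\mathcal{W}_\kappa(\mathcal{Y},\mathcal{E})=\mathcal{W}(\mathcal{Y},\mathcal{E})\cap\mathcal{F}_\kappa(\mathcal{Y},\mathcal{E})$. $\kappa$-congruent embedding: a map $K_\star\colon\mathcal{F}(\mathcal{X},\mathcal{D})\to\mathcal{F}_\kappa(\mathcal{Y},\mathcal{E})$ such that (i) $K_\star$ is linear; (ii) $A\ge0$ entrywise implies $K_\star A\ge0$ entrywise; (iii) $A\in\mathcal{F}_+(\mathcal{X},\mathcal{D})$ implies $K_\star A\in\mathcal{F}_+(\mathcal{Y},\mathcal{E})$; (iv) $\kappa_\star K_\star A=A$ for all $A\in\mathcal{F}(\mathcal{X},\mathcal{D})$. $\kappa$-compatible Markov embedding (on matrices): a map of the form $A\mapsto\Lambda_\star A$, with $\Lambda_\star A(y,y')=A(\kappa(y),\kappa(y'))\Lambda(y,y')$ for $(y,y')\in\mathcal{E}$ and $0$ otherwise, where $\Lambda\in\mathcal{F}_+(\mathcal{Y},\mathcal{E})$ is such that for all $y\in\mathcal{Y}$, $x'\in\mathcal{X}$ with $(\kappa(y),x')\in\mathcal{D}$,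 the vector $(\Lambda(y,y'))_{y'\in\mathcal{S}_{x'}}$ is a probability distribution on $\mathcal{S}_{x'}$. *)

(* Defs.v *)
From HB Require Import structures.
From mathcomp Require Import all_boot all_order all_algebra.
From mathcomp Require Import reals.

Set Implicit Arguments.
Unset Strict Implicit.
Unset Printing Implicit Defensive.

Import Order.TTheory GRing.Theory Num.Theory.
Local Open Scope ring_scope.

(* A digraph on a finite vertex type Y is given by its edge set
   E : {set Y * Y}; loops are allowed. *)
Definition strongly_connected (Y : finType) (E : {set Y * Y}) : Prop :=
  forall y y' : Y, connect (fun a b => (a, b) \in E) y y'.

Definition mat (R : realType) (Y : finType) : Type := {ffun Y * Y -> R}.

(* R itself carries no canonical module structure, only its alias R^o does. *)
HB.instance Definition _ (R : realType) (Y : finType) :=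
  GRing.Lmodule.copy (mat R Y) {ffun Y * Y -> R^o}.

Section Matrices.
Variables (R : realType) (Y : finType) (E : {set Y * Y}).
Implicit Types A B : mat R Y.

(* A(y, S) *)
Definition row_sum A (y : Y) (S : {set Y}) : R := \sum_(s in S) A (y, s).

Definition mat_ge0 A : Prop := forall e, 0 <= A e.

Definition supported : {pred mat R Y} :=
  fun A => [forall e, (e \notin E) ==> (A e == 0)].

(* F_+(Y, E) *)
Definition positive_on A : Prop :=
  A \in supported /\ forall e, e \in E -> 0 < A e.

(* W(Y, E) *)
Definition stochastic A : Prop :=
  positive_on A /\ forall y, row_sum A y setT = 1.

Lemma row_sum_lin (a : R) A B y S :
  row_sum (a *: A + B) y S = a * row_sum A y S + row_sum B y S.
Proof.
rewrite /row_sum mulr_sumr -big_split /=; apply: eq_bigr => s _.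
by rewrite !ffunE.
Qed.

Lemma supported_submod_closed : submod_closed supported.
Proof.
split; first by apply/forallP => e; apply/implyP => _; rewrite ffunE.
move=> a A B /forallP hA /forallP hB; apply/forallP => e; apply/implyP => he.
move: (hA e) (hB e); rewrite he /= => /eqP hAe /eqP hBe.
by rewrite !ffunE hAe hBe scaler0 addr0.
Qed.

HB.instance Definition _ :=
  GRing.isSubmodClosed.Build R (mat R Y) supported supported_submod_closed.

(* F(Y, E) *)
Record supp_mat : Type := SuppMat {
  supp_mat_val :> mat R Y;
  supp_mat_valP : supp_mat_val \in supported }.

HB.instance Definition _ := [isSub for supp_mat_val].
HB.instance Definition _ := [Choice of supp_mat by <:].
HB.instance Definition _ := [SubChoice_isSubLmodule of supp_mat by <:].

End Matrices.

Section Lumping.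
Variables (R : realType) (X Y : finType) (k : Y -> X).
Implicit Types (A B L : mat R Y) (E : {set Y * Y}) (D : {set X * X}).

Definition surjective : Prop := forall x, exists y, k y = x.

(* S_x *)
Definition fiber (x : X) : {set Y} := [set y | k y == x].

Definition kappa2 (e : Y * Y) : X * X := (k e.1, k e.2).

Definition lumpable : {pred mat R Y} := fun A =>
  [forall x, forall x', forall y1 in fiber x, forall y2 in fiber x,
    row_sum A y1 (fiber x') == row_sum A y2 (fiber x')].

Lemma lumpableP A :
  reflect (forall x x' y1 y2, y1 \in fiber x -> y2 \in fiber x ->
             row_sum A y1 (fiber x') = row_sum A y2 (fiber x'))
          (A \in lumpable).
Proof.
apply: (iffP idP) => [/forallP h x x' y1 y2 h1 h2 | h].
  move/(_ x)/forallP/(_ x')/forall_inP/(_ y1 h1)/forall_inP/(_ y2 h2): h.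
  exact: eqP.
apply/forallP => x; apply/forallP => x'; apply/forall_inP => y1 h1.
by apply/forall_inP => y2 h2; apply/eqP; apply: h h1 h2.
Qed.

(* kappa_star A, read off at an arbitrary representative of each fiber; the
   value 0 on an empty fiber is irrelevant when k is surjective. *)
Definition lump A : mat R X := ([ffun e =>
  if [pick y in fiber e.1] is Some y then row_sum A y (fiber e.2) else 0]
  : {ffun X * X -> R}).

Lemma lumpE A x x' y : A \in lumpable -> y \in fiber x ->
  lump A (x, x') = row_sum A y (fiber x').
Proof.
move=> /lumpableP hA hy; rewrite ffunE /=.
by case: pickP => [y0 /hA /(_ hy) //| /(_ y)]; rewrite hy.
Qed.

Lemma lump_supported E A :
  A \in supported E -> lump A \in supported (kappa2 @: E).
Proof.
move=> /forallP hA; apply/forallP => -[x x']; apply/implyP => hx.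
rewrite ffunE /=; case: pickP => [y /[!inE] /eqP hy | //].
apply/eqP; apply: big1 => s /[!inE] /eqP hs; apply/eqP.
apply: (implyP (hA (y, s))); apply: contraNN hx => hE.
by apply/imsetP; exists (y, s) => //; rewrite /kappa2 /= hy hs.
Qed.

Definition supp_lumpable E : {pred mat R Y} :=
  fun A => (A \in supported E) && (A \in lumpable).

Lemma supp_lumpable_submod_closed E : submod_closed (supp_lumpable E).
Proof.
split.
  apply/andP; split; first exact: rpred0.
  by apply/lumpableP => x x' y1 y2 _ _; rewrite /row_sum !big1 // => s _;
     rewrite ffunE.
move=> a A B /andP[sA /lumpableP lA] /andP[sB /lumpableP lB].
apply/andP; split; first by rewrite rpredD // rpredZ.
apply/lumpableP => x x' y1 y2 h1 h2.
by rewrite !row_sum_lin (lA _ x' _ _ h1 h2) (lB _ x' _ _ h1 h2).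
Qed.

HB.instance Definition _ E := GRing.isSubmodClosed.Build R (mat R Y)
  (supp_lumpable E) (supp_lumpable_submod_closed E).

(* F_kappa(Y, E) *)
Record lump_mat E : Type := LumpMat {
  lump_mat_val :> mat R Y;
  lump_mat_valP : lump_mat_val \in supp_lumpable E }.

HB.instance Definition _ E := [isSub for @lump_mat_val E].
HB.instance Definition _ E := [Choice of lump_mat E by <:].
HB.instance Definition _ E := [SubChoice_isSubLmodule of lump_mat E by <:].

Definition congruent_embedding D E (K : supp_mat R D -> lump_mat E) : Prop :=
  [/\ linear K,
      forall A : supp_mat R D, mat_ge0 A -> mat_ge0 (K A),
      forall A : supp_mat R D, positive_on D A -> positive_on E (K A)
    & forall A : supp_mat R D, lump (K A) = A :> mat R X].

(* Lambda_star B *)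
Definition markov_map E L (B : mat R X) : mat R Y :=
  ([ffun e => if e \in E then B (k e.1, k e.2) * L e else 0]
  : {ffun Y * Y -> R}).

Definition row_distribution L (y : Y) (S : {set Y}) : Prop :=
  (forall y', y' \in S -> 0 <= L (y, y')) /\ row_sum L y S = 1.

Definition markov_embedding D E (K : supp_mat R D -> lump_mat E) : Prop :=
  exists L : mat R Y,
    [/\ positive_on E L,
        forall y x', (k y, x') \in D -> row_distribution L y (fiber x')
      & forall A : supp_mat R D, K A = markov_map E L A :> mat R Y].

End Lumping.

(* Main.v *)
(* Let [L] be the image under [K] of the indicator of [D].  If [A >= 0] vanishes
   at [kappa2 k (y, y')], then the nonnegative row [(K A) (y, -)] has zero sum
   over the fiber of [k y'] because [lump (K A) = A], so [(K A) (y, y') = 0].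
   Splitting into positive and negative parts extends this to arbitrary [A];
   applying it to [A] minus a multiple of the indicator of [D] gives
   [K A e = A (kappa2 k e) * L e]. *)

Require Import Defs.
From mathcomp Require Import all_boot all_order all_algebra.
From mathcomp Require Import reals.

Set Implicit Arguments.
Unset Strict Implicit.
Unset Printing Implicit Defensive.

Import Order.TTheory GRing.Theory Num.Theory.
Local Open Scope ring_scope.

Section SupportedMatrices.
Variables (R : realType) (X : finType) (D : {set X * X}).
Implicit Types A : mat R X.

Lemma supportedP A :
  reflect (forall e, e \notin D -> A e = 0) (A \in supported D).
Proof.
apply: (iffP forallP) => [h e he | h e]; first exact/eqP/(implyP (h e)).
by apply/implyP => /h/eqP.
Qed.

Lemma positive_on_ge0 A : positive_on D A -> mat_ge0 A.
Proof.
case=> /supportedP A0 Apos e.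
by have [/Apos/ltW//|/A0->] := boolP (e \in D).
Qed.

Definition edge_indicator : mat R X :=
  ([ffun e => (e \in D)%:R] : {ffun X * X -> R}).

Lemma edge_indicator_supported : edge_indicator \in supported D.
Proof. by apply/supportedP => e /negbTE he; rewrite ffunE he. Qed.

Lemma edge_indicator_positive_on : positive_on D edge_indicator.
Proof.
split; first exact: edge_indicator_supported.
by move=> e he; rewrite ffunE he ltr01.
Qed.

Definition pos_part A : mat R X :=
  ([ffun e => Num.max (A e) 0] : {ffun X * X -> R}).

Lemma pos_part_supported A : A \in supported D -> pos_part A \in supported D.
Proof.
by move=> /supportedP A0; apply/supportedP => e /A0 Ae; rewrite ffunE Ae maxxx.
Qed.

Lemma pos_part_ge0 A : mat_ge0 (pos_part A).
Proof. by move=> e; rewrite ffunE le_max lexx orbT. Qed.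

(** The negative part appears as [pos_part (- A)] with coefficient [-1], which matches the shape
    [a *: A + B] in which linearity is used. *)
Lemma pos_part_decomposition A :
  A = -1 *: pos_part (- A) + pos_part A.
Proof.
apply/ffunP => e; rewrite !ffunE scaleN1r.
have [Ae|Ae] := leP (A e) 0.
  by rewrite max_l ?oppr_ge0// opprK addr0.
by rewrite max_r ?oppr_le0 1?ltW// oppr0 add0r.
Qed.

End SupportedMatrices.

Section Embeddings.
Variables (R : realType) (X Y : finType) (k : Y -> X).
Variables (D : {set X * X}) (E : {set Y * Y}).
Hypothesis surj_k : surjective k.
Hypothesis kappa2_E : [set kappa2 k e | e in E] = D.

Lemma kappa2_edge e : e \in E -> kappa2 k e \in D.
Proof. by move=> he; rewrite -kappa2_E imset_f. Qed.

Lemma lump_matE (B : lump_mat R k E) y x' :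
  lump k B (k y, x') = row_sum B y (fiber k x').
Proof.
by apply: lumpE; [case/andP: (lump_mat_valP B) | rewrite inE].
Qed.

Lemma lump_mat_supported (B : lump_mat R k E) :
  (B : mat R Y) \in supported E.
Proof. by case/andP: (lump_mat_valP B). Qed.

(** Since [L] vanishes off [E], the product already takes the default value [0] there, so no case
    distinction on [e] remains. *)
Lemma markov_mapE (L : mat R Y) (A : mat R X) e :
  L \in supported E -> markov_map k E L A e = A (kappa2 k e) * L e.
Proof.
move=> /supportedP L0; rewrite ffunE.
by case: ifPn => // /L0 ->; rewrite mulr0.
Qed.

Section CongruentIsMarkov.
Variable K : supp_mat R D -> lump_mat R k E.
Hypothesis congrK : congruent_embedding K.

Lemma congruent_linE (a : R) (A B : supp_mat R D) e :
  (K (a *: A + B) : mat R Y) e = a * (K A : mat R Y) e + (K B : mat R Y) e.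
Proof. by case: congrK => -> _ _ _; rewrite !ffunE. Qed.

(** This is [lump (K A) = A] read at the representative [y] of the fiber over [k y]. *)
Lemma congruent_row_sum (A : supp_mat R D) y x' :
  row_sum (K A) y (fiber k x') = (A : mat R X) (k y, x').
Proof. by case: congrK => _ _ _ lumpK; rewrite -lump_matE lumpK. Qed.

Lemma congruent_eq0_ge0 (A : supp_mat R D) e :
  mat_ge0 A -> (A : mat R X) (kappa2 k e) = 0 -> (K A : mat R Y) e = 0.
Proof.
case: e => y y' A_ge0 A0; have KA_ge0 : mat_ge0 (K A).
  by case: congrK => _ K_ge0 _ _; apply: K_ge0.
have /eqP := congruent_row_sum A y (k y').
rewrite [X in _ == X]A0 psumr_eq0; last by move=> s _; apply: KA_ge0.
by move=> /allP/(_ y'); rewrite mem_index_enum inE eqxx => /(_ isT)/eqP.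
Qed.

(** Where [A] vanishes, so do its positive and negative parts, and the nonnegative case applies to
    each. *)
Lemma congruent_eq0 (A : supp_mat R D) e :
  (A : mat R X) (kappa2 k e) = 0 -> (K A : mat R Y) e = 0.
Proof.
move=> A0; have sA := supp_mat_valP A.
have sNA : - (A : mat R X) \in supported D by rewrite rpredN.
pose Ap : supp_mat R D := SuppMat (pos_part_supported sA).
pose Am : supp_mat R D := SuppMat (pos_part_supported sNA).
have -> : A = -1 *: Am + Ap.
  exact/val_inj/pos_part_decomposition.
rewrite congruent_linE (congruent_eq0_ge0 (A := Am)); last 2 first.
- exact: pos_part_ge0.
- by rewrite !ffunE A0 oppr0 maxxx.
rewrite (congruent_eq0_ge0 (A := Ap)) ?mulr0 ?addr0//; first exact: pos_part_ge0.
by rewrite ffunE A0 maxxx.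
Qed.

Lemma congruent_markov : markov_embedding K.
Proof.
pose ind : supp_mat R D := SuppMat (edge_indicator_supported R D).
have posL : positive_on E (K ind).
  by case: congrK => _ _ K_pos _; apply/K_pos/edge_indicator_positive_on.
exists (K ind); split=> // [y x' hD|A].
  split; first by move=> y' _; apply: positive_on_ge0 posL _.
  (* The row sum over the fiber is the value of the indicator at an edge of [D], hence [1]. *)
  by rewrite congruent_row_sum ffunE hD.
apply/ffunP => e; rewrite markov_mapE; last exact: lump_mat_supported.
have [he|he] := boolP (e \in E); last first.
  by rewrite !(supportedP _ _ (lump_mat_supported _)) ?mulr0.
(* The scalar [a] is the entry of [A] at [kappa2 k e], an edge of [D] where [ind] is [1]. So [B]
   vanishes there, and only [a * K ind e] survives. *)
set a := (A : mat R X) _; pose B : supp_mat R D := (- a) *: ind + A.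
have -> : A = a *: ind + B by rewrite /B scaleNr addrA subrr add0r.
rewrite congruent_linE (congruent_eq0 (A := B)) ?addr0//.
have -> : (B : mat R X) = - a *: edge_indicator R D + (A : mat R X) by [].
by rewrite !ffunE kappa2_edge//= [_ *: _]mulr1 addNr.
Qed.

End CongruentIsMarkov.

(** The entrywise product formula yields linearity and both sign conditions. Along a fiber the
    factor coming from [A] is constant, so a row sum of [K A] is that factor times a row sum of
    [L]. *)
Lemma markov_congruent (K : supp_mat R D -> lump_mat R k E) :
  markov_embedding K -> congruent_embedding K.
Proof.
case=> L [posL distL KE]; have [sL _] := posL; have L_ge0 := positive_on_ge0 posL.
have KEe A e : (K A : mat R Y) e = (A : mat R X) (kappa2 k e) * L e.
  by rewrite KE markov_mapE.
split=> [a A B|A A_ge0 e|A [_ Apos]|A].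
- apply/val_inj/ffunP => e; rewrite !ffunE /= !KEe !ffunE mulrDl.
  by rewrite -mulrA.
- by rewrite KEe mulr_ge0.
- split=> [|e he]; first exact: lump_mat_supported.
  by rewrite KEe mulr_gt0 ?Apos ?kappa2_edge//; case: posL => _; apply.
- apply/ffunP => -[x x']; have [y <-] := surj_k x; rewrite lump_matE.
  have -> : row_sum (K A) y (fiber k x') =
            (A : mat R X) (k y, x') * row_sum L y (fiber k x').
    rewrite /row_sum mulr_sumr; apply: eq_bigr => y' /[!inE] /eqP hy'.
    by rewrite KEe /kappa2 /= hy'.
  (* On [D] the row of [L] sums to [1] over the fiber; off [D] its sum is irrelevant because [A] is
     [0] there. *)
  have [/distL[_ ->]|hD] := boolP ((k y, x') \in D); first by rewrite mulr1.
  by rewrite (supportedP _ _ (supp_mat_valP A)) ?mul0r.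
Qed.

End Embeddings.

Theorem theorem4p1 (R : realType) (X Y : finType)
    (D : {set X * X}) (E : {set Y * Y}) (k : Y -> X)
    (cardX : (1 < #|X|)%N) (cardY : (1 < #|Y|)%N)
    (connD : strongly_connected D) (connE : strongly_connected E)
    (surj_k : surjective k) (kappa2_E : [set kappa2 k e | e in E] = D)
    (W_nonempty : exists P : mat R Y, stochastic E P /\ P \in lumpable k)
    (K : supp_mat R D -> lump_mat R k E) :
  congruent_embedding K <-> markov_embedding K.
Proof.
split; first exact: congruent_markov.
exact: markov_congruent.
Qed.
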